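(* Let $n\ge 1$ and let $t=p_1p_2\cdots p_n$, where $p_1,p_2,\dots,p_n$ are odd integers (not necessarily prime or distinct) with $p_i>1$ for $1\le i\le n$. For any prime power $q$ with $q\equiv 1\pmod 4$, there exists a $(qt,2;(q-1)2^{n-1},\frac{qt-1}{2};(q-1)2^{n-2},(q-1)2^{n-2})$-GSEDF (in some abelian group of order $qt$).
   Context: Let $G$ be a finite abelian group of order $v$, written additively with identity $0$. For disjoint subsets $A,B\subseteq G$, let $\Delta(A,B)$ be the multiset $\{x-y : x\in A, y\in B\}$. For positive integers $k_1,k_2,\lambda_1,\lambda_2$, a $(v,2;k_1,k_2;\lambda_1,\lambda_2)$-generalized strong external difference family (GSEDF) in $G$ is a pair $\{D_1,D_2\}$ of disjoint subsets of $G$ with $|D_1|=k_1$, $|D_2|=k_2$ such that $\Delta(D_1,D_2)$ contains every element of $G\setminus\{0\}$ exactly $\lambda_1$ times and $\Delta(D_2,D_1)$ contains every element of $G\setminus\{0\}$ exactly $\lambda_2$ times. *)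

(* Defs.v *)
From HB Require Import structures.
From mathcomp Require Import all_boot all_order all_algebra.

Set Implicit Arguments.
Unset Strict Implicit.
Unset Printing Implicit Defensive.

Import GRing.Theory.

Definition prime_power (q : nat) : Prop :=
  exists r e : nat, [/\ prime r, 0 < e & q = r ^ e].

(* The multiset {x - y : x in A, y in B}, represented as a list whose order is
   irrelevant; the multiplicity of g in it is [count_mem g (Delta A B)]. *)
Definition Delta (G : finZmodType) (A B : {set G}) : seq G :=
  [seq (x - y)%R | x <- enum A, y <- enum B].

Definition is_GSEDF (v k1 k2 l1 l2 : nat) (G : finZmodType) (D1 D2 : {set G})
    : Prop :=
  [/\ [/\ 0 < k1, 0 < k2, 0 < l1 & 0 < l2],
      #|G| = v,
      [disjoint D1 & D2],
      #|D1| = k1 /\ #|D2| = k2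
    & forall g : G, g != 0%R ->
        count_mem g (Delta D1 D2) = l1 /\ count_mem g (Delta D2 D1) = l2].

(* Main.v *)
(* Encode D2 by the sign function u = 1 - 2 * 1_{D2}. If u = 1 on D1 and
   \sum_(x in D1) u(x - g) = 0 for every g != 0 (convolution with u inverts D1 up
   to a scalar), then (D1, D2) is a GSEDF with 2 * lambda = #|D1|. Such pairs are
   closed under direct products: take D1 x D1' with sign u(x) u'(y). The theorem
   multiplies the pair (squares, nonsquares) of the field with q elements by
   the pairs ({0, 1}, {2, 4, ..., p - 1}) of the cyclic groups of orders p_i. *)
Require Import Defs.
From HB Require Import structures.
From mathcomp Require Import all_boot all_order all_algebra all_field.
From mathcomp Require Import zify ring.

Set Implicit Arguments.
Unset Strict Implicit.
Unset Printing Implicit Defensive.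

Import Order.TTheory GRing.Theory Num.Theory.

Local Open Scope ring_scope.

(** * Sign functions and the GSEDF they produce *)

Definition set_sign (T : finType) (E : {set T}) (x : T) : int :=
  (-1) ^+ (x \in E).

Lemma set_signE (T : finType) (E : {set T}) (x : T) :
  set_sign E x = 1 - (x \in E)%:R *+ 2.
Proof. by rewrite /set_sign; case: (x \in E). Qed.

Lemma natrB_double_eq (a b c : nat) :
  a%:R - b%:R *+ 2 = c%:R :> int -> (b.*2 + c)%N = a.
Proof. by rewrite mulr2n !natz; lia. Qed.

Definition sign_inverse (G : finZmodType) (D E : {set G}) : Prop :=
  [disjoint D & E] /\
  forall g : G, g != 0 -> \sum_(x in D) set_sign E (x - g) = 0.

Section SignInverse.

Variables (G : finZmodType) (D E : {set G}).
Hypothesis sDE : sign_inverse D E.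

Lemma sum_set_sign0 : \sum_(x in D) set_sign E x = #|D|%:R.
Proof.
case: sDE => dDE _; rewrite -sumr_const; apply: eq_bigr => x xD.
by rewrite /set_sign (disjointFr dDE xD).
Qed.

(** Sum the defining sums over all [g]: only [g = 0] contributes, which gives [#|D|]. Exchanging the
    sums gives [#|D|] times the total of the sign, so this total, [#|G| - 2 #|E|], is 1. *)
Lemma sign_inverse_card : (0 < #|D|)%N -> (#|E|.*2.+1 = #|G|)%N.
Proof.
move=> D_gt0; have [_ sum0] := sDE.
have sumU : \sum_(x : G) set_sign E x = #|G|%:R - #|E|%:R *+ 2 :> int.
  under eq_bigr do rewrite set_signE.
  rewrite sumrB sumr_const sumrMnl -natr_sum.
  by rewrite -big_mkcond /= sum1_card cardT cardE.
have : \sum_(g : G) \sum_(x in D) set_sign E (x - g) = #|D|%:R.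
  rewrite (bigD1 0) //= [X in _ + X]big1 ?addr0; last by move=> g /sum0.
  by under eq_bigr do rewrite subr0; exact: sum_set_sign0.
rewrite exchange_big /=.
have shift x : \sum_g set_sign E (x - g) = \sum_g set_sign E g.
  rewrite [RHS](reindex (fun g => x - g)) //.
  by exists (fun g => x - g) => g _; rewrite subKr.
under eq_bigr do rewrite shift.
rewrite sumr_const sumU -[LHS]mulr_natl -[RHS]mulr1.
have D_neq0 : #|D|%:R != 0 :> int by rewrite pnatr_eq0 -lt0n.
by move=> /(mulfI D_neq0) /(natrB_double_eq (c := 1)); rewrite addn1.
Qed.

(** A vanishing sum of signs has as many terms -1 as terms 1. *)
Lemma sign_inverse_shift (g : G) : g != 0 ->
  (#|[set x in D | (x - g)%R \in E]|.*2 = #|D|)%N.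
Proof.
move=> g_neq0; have [_ /(_ g g_neq0)] := sDE.
under eq_bigr do rewrite set_signE.
rewrite sumrB sumr_const sumrMnl -natr_sum -big_mkcondr /=.
have -> : (\sum_(i in D | (i - g)%R \in E) 1)%N = #|[set x in D | x - g \in E]|.
  by rewrite -sum1_card; apply: eq_bigl => x; rewrite inE.
by move=> /(natrB_double_eq (c := 0)); rewrite addn0.
Qed.

End SignInverse.

Lemma count_mem_Delta (G : finZmodType) (A B : {set G}) (g : G) :
  count_mem g (Delta A B) = #|[set x in A | x - g \in B]|.
Proof.
rewrite /Delta -sum1_count big_mkcond big_allpairs_dep big_enum /= -sum1_card.
under [RHS]eq_bigl do rewrite inE.
rewrite [RHS]big_mkcondr /=; apply: eq_bigr => x _.
rewrite big_enum -big_mkcondr /=.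
rewrite (eq_bigl (fun y => (y == x - g) && (x - g \in B))); last first.
  by move=> y; rewrite subr_eq addrC -subr_eq eq_sym andbC; case: eqP => // ->.
case: (x - g \in B); last by rewrite big_pred0 // => y; rewrite andbF.
by rewrite (big_pred1 (x - g)) // => y; rewrite andbT.
Qed.

(** Translation by [g] turns the count over [B] into a count over [A], of the form handled by
    [sign_inverse_shift] at [- g]. *)
Lemma count_mem_DeltaC (G : finZmodType) (A B : {set G}) (g : G) :
  count_mem g (Delta B A) = #|[set x in A | x + g \in B]|.
Proof.
rewrite count_mem_Delta -[RHS](card_imset _ (addIr g)).
apply: eq_card => y; rewrite inE; apply/andP/imsetP => [[yB yA]|[x]].
  by exists (y - g); rewrite ?inE ?subrK ?yA.
by rewrite inE => /andP[xA xB] ->; rewrite addrK.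
Qed.

Lemma sign_inverse_GSEDF (G : finZmodType) (D E : {set G}) (v k : nat) :
    sign_inverse D E -> #|G| = v -> #|D| = k -> (1 < v)%N -> (0 < k)%N ->
  is_GSEDF v k ((v - 1) %/ 2) (k %/ 2) (k %/ 2) D E.
Proof.
move=> sDE cardG cardD v_gt1 k_gt0.
have cardE : (#|E|.*2.+1 = v)%N by rewrite -cardG (sign_inverse_card sDE) ?cardD.
have half_k g : g != 0 -> (#|[set x in D | (x - g)%R \in E]|.*2 = k)%N.
  by move=> /(sign_inverse_shift sDE); rewrite cardD.
have [g g_neq0] : exists g : G, g != 0.
  have /card_gt0P[g] : (0 < #|[set~ 0%R : G]|)%N.
    by rewrite cardsC1 -subn1 subn_gt0 cardG.
  by rewrite !inE => g_neq0; exists g.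
have kE := half_k g g_neq0.
split => //; first by split => //; lia.
- by case: sDE.
- by split => //; lia.
move=> {g_neq0 kE}g g_neq0.
have kE := half_k g g_neq0.
have := half_k (- g); rewrite oppr_eq0 opprK => /(_ g_neq0) kNE.
by split; [rewrite count_mem_Delta -kE | rewrite count_mem_DeltaC -kNE];
  rewrite -muln2 mulnK.
Qed.

(** * Direct products and cyclic factors *)

HB.instance Definition _ (G H : finZmodType) := GRing.Zmodule.on (G * H)%type.

(** Exclusive or of memberships multiplies the signs, so the sum over [setX D A] factors. If
    [(g, h)] is nonzero, then one of the two factors vanishes. *)
Lemma sign_inverseX (G H : finZmodType) (D E : {set G}) (A B : {set H}) :
    sign_inverse D E -> sign_inverse A B ->
  sign_inverse (G := (G * H)%type) (setX D A)
    [set z : G * H | (z.1 \in E) (+) (z.2 \in B)].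
Proof.
move=> [dDE sumD] [dAB sumA]; split.
  rewrite disjoint_subset; apply/subsetP => -[x y] /setXP[xD yA].
  by rewrite !inE /= (disjointFr dDE xD) (disjointFr dAB yA).
move=> [g h] gh_neq0.
pose F x y := set_sign E (x - g) * set_sign B (y - h).
transitivity (\sum_(x in D) \sum_(y in A) F x y).
  rewrite pair_big_dep /=; apply: eq_big => [[x y]|[x y] _]; first by rewrite inE.
  by rewrite /F /set_sign inE signr_addb.
rewrite /F; under eq_bigr do rewrite -mulr_sumr.
rewrite -mulr_suml; have [g0|/sumD ->] := eqVneq g 0; last by rewrite mul0r.
by rewrite sumA ?mulr0 //; apply: contraNneq gh_neq0 => ->; rewrite g0.
Qed.

(** With [y = - h] nonzero, the sum has the two terms at [y] and [y + 1]. Consecutive residues have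
    opposite parity, hence opposite signs, unless [y + 1] wraps around to 0. *)
Lemma sign_inverse_cyclic (m : nat) : odd m -> (1 < m)%N ->
  exists (H : finZmodType) (A B : {set H}),
    [/\ #|H| = m, #|A| = 2%N & sign_inverse A B].
Proof.
case: m => [|[|k]] //= odd_k _.
pose H : finZmodType := 'I_k.+2.
pose B : {set H} := [set y : H | ~~ odd y & y != 0].
have neq01 : (0 : H) != 1 by [].
exists H, [set 0; 1], B; split; first by rewrite card_ord.
  by rewrite cards2 neq01.
split; first by rewrite disjoint_subset; apply/subsetP => y;
  rewrite !inE => /orP[]/eqP->.
move=> h h_neq0; rewrite big_setU1 ?inE //= big_set1 sub0r.
have : - h != 0 by rewrite oppr_eq0.
rewrite [1 - h]addrC; move: (- h) => y y_neq0.
rewrite /set_sign !inE y_neq0 andbT.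
have val_y1 : (y + 1 : H) = (y.+1 %% k.+2)%N :> nat.
  by rewrite -[in RHS](addn1 y) -[RHS]modnDmr.
(* Wraparound: [y = m - 1] is even and nonzero, so its sign is -1, while 0 is excluded from [B] and
   has sign 1. *)
have [y_max|y_lt] := eqVneq (y : nat) k.+1.
  have -> : y + 1 = 0 by apply: val_inj; rewrite [LHS]val_y1 y_max modnn.
  by rewrite y_max /= odd_k.
have yS : (y + 1 : H) = y.+1 :> nat.
  by rewrite val_y1 modn_small // ltnS ltn_neqAle y_lt -ltnS ltn_ord.
have -> : (y + 1 : H) != 0 by apply/eqP => /(congr1 val); rewrite [X in X = _]yS.
by rewrite yS /= andbT; case: (odd y).
Qed.

(** * The quadratic character and the pair of squares and nonsquares *)

Section QuadraticCharacter.

Variables (F : finFieldType) (h : nat).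
Hypothesis cardF : #|F| = h.*2.+1.

(** The quadratic character by Euler's criterion, with integer values so that its sums are not
    reduced modulo the characteristic. *)
Definition qchar (x : F) : int :=
  if x == 0 then 0 else if x ^+ h == 1 then 1 else -1.


Let h_gt0 : (0 < h)%N.
Proof. by have := finNzRing_gt1 F; rewrite cardF; case: (h). Qed.

Lemma qchar0 : qchar 0 = 0.
Proof. by rewrite /qchar eqxx. Qed.

Lemma qchar_cases (x : F) : x != 0 -> qchar x = 1 \/ qchar x = -1.
Proof. by move=> /negPf x0; rewrite /qchar x0; case: ifP; [left|right]. Qed.

Lemma expf_half (x : F) : x != 0 -> x ^+ h = 1 \/ x ^+ h = -1.
Proof.
move=> x0; have /eqP : (x ^+ h) ^+ 2 = 1.
  apply: (mulfI x0); rewrite mulr1 -exprM muln2 -exprS -cardF.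
  exact: expf_card.
by rewrite sqrf_eq1 => /orP[]/eqP; [left|right].
Qed.

Lemma qcharM : {morph qchar : x y / x * y}.
Proof.
move=> x y; rewrite /qchar mulf_eq0.
have [//|x0] := eqVneq x 0; first by rewrite mul0r.
have [_|y0] := eqVneq y 0; first by rewrite mulr0.
rewrite exprMn; have [->|x1] := eqVneq (x ^+ h) 1; first by rewrite !mul1r.
have [->|y1] := eqVneq (y ^+ h) 1; first by rewrite !mulr1 (negPf x1).
case: (expf_half x0) x1 => ->; rewrite ?eqxx // => _.
by case: (expf_half y0) y1 => ->; rewrite ?eqxx // => _; rewrite mulrNN mul1r eqxx.
Qed.

Lemma qchar1 : qchar 1 = 1.
Proof. by rewrite /qchar oner_eq0 expr1n eqxx. Qed.

Lemma qcharV (x : F) : qchar x^-1 = qchar x.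
Proof. by rewrite /qchar invr_eq0 exprVn invr_eq1. Qed.

Lemma qcharN (x : F) : ~~ odd h -> qchar (- x) = qchar x.
Proof.
by move=> /negPf h_even; rewrite /qchar oppr_eq0 exprNn -signr_odd h_even mul1r.
Qed.

(** The equation [x ^+ h = 1] has at most [h] roots, but there are [2h] nonzero elements. *)
Lemma qchar_nonresidue : exists2 a : F, a != 0 & qchar a = -1.
Proof.
have [a /andP[a0 a1]|all1] := pickP (fun a : F => (a != 0) && (a ^+ h != 1)).
  by exists a => //; rewrite /qchar (negPf a0) (negPf a1).
have := max_unity_roots h_gt0 (rs := enum (predC1 (0 : F))).
rewrite enum_uniq -cardE cardC1 cardF /=.
suff -> : all h.-unity_root (enum (predC1 (0 : F))) by move=> /(_ isT isT); lia.
apply/allP => x; rewrite mem_enum inE /= => x0; rewrite unity_rootE.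
by have := all1 x; rewrite x0 /= => /negbFE.
Qed.

(** Multiplication by a nonresidue permutes [F] and negates every term. *)
Lemma sum_qchar : \sum_x qchar x = 0.
Proof.
have [a a0 qa] := qchar_nonresidue.
have : \sum_x qchar x = - \sum_x qchar x.
  rewrite {1}(reindex (fun x => a * x)) /=; last first.
    by exists (fun x => a^-1 * x) => x _; rewrite ?mulKf ?mulVKf.
  by under eq_bigr do rewrite qcharM qa mulN1r; rewrite sumrN.
lia.
Qed.

Lemma sum_delta (f : F -> int) (a : F) : \sum_x (x == a)%:R * f x = f a.
Proof.
rewrite (bigD1 a) //= eqxx mul1r big1 ?addr0 // => x /negPf ->.
by rewrite mul0r.
Qed.

(** For [x != 0] the term equals [qchar (1 - g / x)], because [qchar x = qchar x^-1]. Over all [x]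
    these values sum to 0. *)
Lemma sum_qchar_shift (g : F) : g != 0 ->
  \sum_x qchar x * qchar (x - g) = -1.
Proof.
move=> g0.
(* The reindexing x = g / (1 - y) is a bijection of F because 0^-1 = 0. *)
have sum1g : \sum_x qchar (1 - g / x) = 0.
  rewrite (reindex (fun y => g / (1 - y))) /=; last first.
    exists (fun x => 1 - g / x) => x _ /=.
      by rewrite invf_div mulrCA mulfV // mulr1 subKr.
    by rewrite subKr invf_div mulrCA mulfV // mulr1.
  rewrite -[RHS]sum_qchar; apply: eq_bigr => y _.
  by rewrite invf_div mulrCA mulfV // mulr1 subKr.
(* At [x = 0] the original term is 0 but [qchar (1 - g / 0) = qchar 1 = 1]; the correction removes
   this 1 and yields -1. *)
rewrite (eq_bigr (fun x => qchar (1 - g / x) - (x == 0)%:R * 1)).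
  by rewrite sumrB sum1g (sum_delta (fun=> 1)) sub0r.
move=> x _; have [->|x0] := eqVneq x 0.
  by rewrite qchar0 invr0 mulr0 subr0 qchar1 mul0r mul1r subrr.
by rewrite mul0r subr0 -[in LHS]qcharV -qcharM mulrBr mulVf // mulrC.
Qed.

Lemma sign_inverse_qchar : ~~ odd h ->
  #|[set x | qchar x == 1]| = h /\
  sign_inverse [set x | qchar x == 1] [set x | qchar x == -1].
Proof.
move=> h_even; set D := [set x | _ == 1]; set E := [set x | _ == -1].
(* The indicator of [D] is doubled to avoid dividing by 2 in the integers. *)
have D_double x : (x \in D)%:R *+ 2 = qchar x + 1 - (x == 0)%:R * 1.
  rewrite inE; have [->|x0] := eqVneq x 0; first by rewrite qchar0.
  by case: (qchar_cases x0) => ->.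
have signE x : set_sign E x = qchar x + (x == 0)%:R.
  rewrite /set_sign inE; have [->|x0] := eqVneq x 0; first by rewrite qchar0.
  by case: (qchar_cases x0) => ->.
split.
  have : (\sum_x (x \in D)%:R) *+ 2 = h.*2%:R :> int.
    rewrite -sumrMnl; under eq_bigr do rewrite D_double.
    rewrite sumrB big_split /= sum_qchar (sum_delta (fun=> 1)) add0r.
    by rewrite sumr_const cardF -addn1 natrD addrK.
  rewrite -natr_sum -big_mkcond /= sum1_card -mulrnA muln2 => /eqP.
  by rewrite eqr_nat => /eqP/double_inj.
split.
  by rewrite disjoint_subset; apply/subsetP => x; rewrite !inE => /eqP ->.
move=> g g0.
suff : (\sum_(x in D) set_sign E (x - g)) *+ 2 = 0.
  by move=> /eqP; rewrite mulrn_eq0 => /eqP.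
have -> : (\sum_(x in D) set_sign E (x - g)) *+ 2 =
    \sum_x ((x \in D)%:R *+ 2) * set_sign E (x - g).
  rewrite big_mkcond -sumrMnl; apply: eq_bigr => x _ /=.
  by case: (x \in D); rewrite ?mul0r // mulrnAl mul1r.
transitivity (\sum_x (qchar x * qchar (x - g) + (x == g)%:R * (qchar x + 1)
    + qchar (x - g) - (x == 0)%:R * qchar (x - g))).
  apply: eq_bigr => x _; rewrite D_double signE subr_eq0 mulr1.
  have [->|_] := eqVneq x 0; last by rewrite /= mulr0n; ring.
  by rewrite [0 == g]eq_sym (negPf g0) /= mulr0n mulr1n; ring.
(* The four sums are -1, [qchar g + 1], 0 and [qchar (- g)]. Since [h] is even, -1 is a square, so
   the last is [qchar g] and everything cancels. *)
rewrite sumrB !big_split /= sum_qchar_shift // (sum_delta (fun x => qchar x + 1)).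
rewrite (sum_delta (fun x => qchar (x - g))) sub0r qcharN //.
have -> : \sum_x qchar (x - g) = 0.
  rewrite -[RHS]sum_qchar [RHS](reindex (fun x => x - g)) //.
  by exists (fun x => x + g) => x _; rewrite ?subrK ?addrK.
by ring.
Qed.

End QuadraticCharacter.

(** * Assembling the factors *)

Lemma sign_inverse_field (q : nat) : prime_power q -> (q = 1 %[mod 4])%N ->
  exists (G : finZmodType) (D E : {set G}),
    [/\ #|G| = q, (#|D|.*2.+1 = q)%N & sign_inverse D E].
Proof.
move=> [r [e [r_pr e_gt0 def_q]]] q1.
have [F _] := pPrimePowerField r_pr e_gt0; rewrite -def_q => cardF.
have q_gt1 : (1 < q)%N by rewrite -cardF finNzRing_gt1.
(* Here [h = (q - 1) / 2] is written as a double, which makes its evenness evident. *)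
have cardF2 : #|F| = ((q %/ 4).*2).*2.+1 by rewrite cardF; lia.
have [|cardD sDE] := sign_inverse_qchar cardF2; first by rewrite odd_double.
exists F, [set x | qchar (q %/ 4).*2 x == 1], [set x | qchar (q %/ 4).*2 x == -1].
by split; rewrite ?cardD -?cardF2.
Qed.

Lemma sign_inverse_prod (s : seq nat) (G : finZmodType) (D E : {set G}) :
    sign_inverse D E -> {in s, forall m, odd m && (1 < m)%N} ->
  exists (G' : finZmodType) (D' E' : {set G'}),
    [/\ #|G'| = (#|G| * \prod_(m <- s) m)%N, #|D'| = (#|D| * 2 ^ size s)%N
      & sign_inverse D' E'].
Proof.
move=> sDE; elim: s => [|m s IHs] s_odd.
  by exists G, D, E; rewrite big_nil !muln1.
have [x xs|G' [D' [E' [cardG' cardD' sDE']]]] := IHs.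
  by apply: s_odd; rewrite inE xs orbT.
have /andP[m_odd m_gt1] := s_odd m (mem_head m s).
have [H [A [B [cardH cardA sAB]]]] := sign_inverse_cyclic m_odd m_gt1.
exists (G' * H)%type, (setX D' A), [set z : G' * H | (z.1 \in E') (+) (z.2 \in B)].
split; last exact: sign_inverseX.
  by rewrite card_prod cardG' cardH big_cons -mulnA [(m * _)%N]mulnC.
by rewrite cardsX cardD' cardA expnSr mulnA.
Qed.

Local Close Scope ring_scope.

(* (q - 1) 2^(n-2) is written (q - 1) * 2 ^ n %/ 4 so that n = 1 is covered;
   the division is exact since 4 divides q - 1. *)
Theorem theorem4p10 (n : nat) (hn : 1 <= n) (p : 'I_n -> nat)
    (hodd : forall i : 'I_n, odd (p i)) (hgt1 : forall i : 'I_n, 1 < p i)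
    (q : nat) (hq : prime_power q) (hq4 : q = 1 %[mod 4]) :
  let t := \prod_(i < n) p i in
  exists (G : finZmodType) (D1 D2 : {set G}),
    is_GSEDF (q * t)
      ((q - 1) * 2 ^ (n - 1)) ((q * t - 1) %/ 2)
      ((q - 1) * 2 ^ n %/ 4) ((q - 1) * 2 ^ n %/ 4)
      D1 D2.
Proof.
move=> t; have [F [D [E [cardF cardD sDE]]]] := sign_inverse_field hq hq4.
have [x|G [D1 [D2 [cardG cardD1 sD12]]]] :=
  sign_inverse_prod (s := [seq p i | i <- enum 'I_n]) sDE.
  by move=> /mapP[i _ ->]; rewrite hodd hgt1.
rewrite big_map big_enum /= cardF -/t in cardG.
rewrite size_map size_enum_ord in cardD1.
exists G, D1, D2.
have q_gt1 : 1 < q.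
  by case: hq => r [e [r_pr e_gt0 ->]]; rewrite -(exp1n e) ltn_exp2r ?prime_gt1.
have t_gt0 : 0 < t by rewrite prodn_gt0 // => i; exact: ltnW.
have exp2n : 2 ^ n = 2 * 2 ^ (n - 1) by rewrite -expnS subn1 prednK.
(* The set of squares has [(q - 1) / 2] elements and each cyclic factor doubles the size. *)
have cardDn : #|D| * 2 ^ n = (q - 1) * 2 ^ (n - 1).
  by rewrite -cardD exp2n subSS subn0 -muln2 mulnA.
have -> : (q - 1) * 2 ^ n %/ 4 = (q - 1) * 2 ^ (n - 1) %/ 2.
  by rewrite exp2n mulnCA (divnMl (p := 2) (d := 2)).
apply: sign_inverse_GSEDF => //.
- by rewrite cardD1.
- by rewrite (leq_trans q_gt1) // leq_pmulr.
- by rewrite muln_gt0 subn_gt0 q_gt1 expn_gt0.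
Qed.
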